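(* For every integer $n\ge 0$, $M_n(x)$ is a monic polynomial of degree $3^n$ and its coefficients satisfy $$\frac{M_n(2x+1)}{2^{3^n}}\in\mathbb{Z}[x].$$ The degree of $Z_n$ as a rational function of $y$ is $4\cdot 3^n$.
   Context: Sierpinski gasket graphs: $\mathcal{G}_0$ is a triangle (three vertices, three edges), whose three vertices are its external corners. For $n\ge 1$, $\mathcal{G}_n$ is obtained from three copies of $\mathcal{G}_{n-1}$ by joining them at their external corners: for each pair of copies, one external corner of one copy is identified with one external corner of the other, the three identifications using six distinct corners; the three remaining unidentified corners are the external corners of $\mathcal{G}_n$. Ising model: for a finite graph with vertex set $\mathcal{V}$ and edge set $\mathcal{E}$, a spin configuration is a map $\sigma:\mathcal{V}\to\{\pm1\}$; its Hamiltonian is $H(\sigma)=-J\sum_{\langle v,w\rangle\in\mathcal{E}}\sigma(v)\sigma(w)$ with $J>0$ constant (each edge counted once); its Gibbs weight is $W(\sigma)=e^{-H(\sigma)/T}$ with $T>0$. Put $y=e^{J/T}$. The partition function $Z_n$ is the sum of $W(\sigma)$ over all spin configurations on $\mathcal{G}_n$; equivalently $Z_n(y)=\sum_{\sigma}y^{\sum_{\langle v,w\rangle}\sigma(v)\sigma(w)}$, a Laurent polynomial in $y$ (e.g. $Z_0(y)=2y^3+6y^{-1}$). The polynomial $M_n\in\mathbb{Z}[x]$ is defined by $M_n(y^4)=\frac{y^{3^n}Z_n(y)}{2}$. It satisfies $M_0(x)=x+3$ and, for $n\ge1$, $M_n(x)=M_{n-1}(f(x))[(x+1)(x+3)]^{3^{n-1}}$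 with $f(x)=\frac{x^2-x+4}{x+3}$. The degree of a rational function is its degree as a map of the Riemann sphere, i.e. the maximum of the degrees of numerator and denominator in lowest terms. *)

(* Defs.v *)
From HB Require Import structures.
From mathcomp Require Import all_boot all_order all_algebra generic_quotient.
From mathcomp Require Import complex.
From mathcomp Require Import reals sequences exp.

Set Implicit Arguments.
Unset Strict Implicit.
Unset Printing Implicit Defensive.

Import Order.TTheory GRing.Theory Num.Theory.
Local Open Scope ring_scope.
Local Open Scope quotient_scope.

(* Finite simple graphs with three distinct external corners; an edge is the
   two-element set of its endpoints. *)
Record cgraph := CGraph {
  vertex : finType;
  edges : {set {set vertex}};
  corner : 'I_3 -> vertex;
  edges_card : forall e, e \in edges -> #|e| = 2%N;
  corner_inj : injective corner
}.

Section Triangle.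

Definition triangle_edges : {set {set 'I_3}} := [set e : {set 'I_3} | #|e| == 2%N].

Lemma triangle_edges_card e : e \in triangle_edges -> #|e| = 2%N.
Proof. by rewrite inE => /eqP. Qed.

Definition triangle : cgraph := CGraph triangle_edges_card (@inj_id 'I_3).

End Triangle.

Section Glue.
Variable G : cgraph.

(* [(i, v)] is the vertex [v] of the copy number [i] of [G].  For [i != j],
   the corner [j] of the copy [i] is identified with the corner [i] of the
   copy [j]; the corner [i] of each copy [i] stays external. *)
Definition glue_rel : rel ('I_3 * vertex G) := fun p q =>
  (p == q) || [&& p.1 != q.1, p.2 == corner G q.1 & q.2 == corner G p.1].

Lemma glue_rel_refl : reflexive glue_rel.
Proof. by move=> p; rewrite /glue_rel eqxx. Qed.

Lemma glue_rel_sym : symmetric glue_rel.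
Proof.
move=> p q; rewrite /glue_rel (eq_sym p q) (eq_sym p.1).
by rewrite (andbC (p.2 == _)).
Qed.

Lemma glue_rel_trans : transitive glue_rel.
Proof.
move=> [j v] [i u] [k w]; rewrite /glue_rel /=.
case/predU1P => [[-> ->] //|/and3P[ij /eqP u_j /eqP v_i]].
case/predU1P => [[<- <-]|/and3P[jk /eqP v_k /eqP w_j]].
  by rewrite /= u_j v_i ij !eqxx orbT.
have ik : i = k by apply: (@corner_inj G); rewrite -v_i.
by rewrite -ik u_j w_j eqxx.
Qed.

Canonical glue_equiv :=
  EquivRel glue_rel glue_rel_refl glue_rel_sym glue_rel_trans.

Definition glue_vertex : finType := quot_type {eq_quot glue_equiv}.

Definition copy (i : 'I_3) (v : vertex G) : glue_vertex :=
  \pi_{eq_quot glue_equiv} (i, v).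

Lemma copyE i u j v : (copy i u == copy j v) = glue_rel (i, u) (j, v).
Proof. by apply/eqP/idP => [/eqmodP|?]; [|apply/eqmodP]. Qed.

Lemma copy_inj i : injective (copy i).
Proof.
move=> u v /eqP; rewrite copyE /glue_rel /= eqxx orbF.
by move=> /eqP[].
Qed.

Definition glue_edges : {set {set glue_vertex}} :=
  [set copy i @: (e : {set vertex G}) | i : 'I_3, e : {set vertex G} in edges G].

Definition glue_corner (i : 'I_3) : glue_vertex := copy i (corner G i).

Lemma glue_edges_card e : e \in glue_edges -> #|e| = 2%N.
Proof.
case/imset2P => i d _ dE ->.
by rewrite card_imset; [exact: edges_card dE|exact: copy_inj].
Qed.

Lemma glue_corner_inj : injective glue_corner.
Proof.
move=> i j /eqP; rewrite copyE /glue_rel /=.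
case/predU1P => [[]//|/and3P[_ /eqP ij _]].
exact: (@corner_inj G).
Qed.

Definition glue : cgraph := CGraph glue_edges_card glue_corner_inj.

End Glue.

Definition gasket (n : nat) : cgraph := iter n glue triangle.

Section Ising.
Variable G : cgraph.

Definition config := {ffun vertex G -> bool}.

(* [true] encodes the spin -1, [false] the spin +1. *)
Definition spin (s : config) (v : vertex G) : int := (-1) ^+ s v.

Definition interaction (s : config) : int :=
  \sum_(e in edges G) \prod_(v in e) spin s v.

Definition Zpart (K : unitRingType) (y : K) : K :=
  \sum_(s : config) y ^ interaction s.

Definition hamiltonian (R : realType) (J : R) (s : config) : R :=
  - J * (interaction s)%:~R.

Definition gibbs_weight (R : realType) (J T : R) (s : config) : R :=
  expR (- hamiltonian J s / T).

Lemma gibbs_partitionE (R : realType) (J T : R) :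
  \sum_(s : config) gibbs_weight J T s = Zpart (expR (J / T)).
Proof.
apply: eq_bigr => s _; rewrite /gibbs_weight /hamiltonian !mulNr opprK mulrAC.
case: (interaction s) => k.
  by rewrite -exprnP -expRM_natr.
by rewrite NegzE mulrNz mulrN expRN -exprnN -expRM_natr.
Qed.

End Ising.

Section RationalFunctions.
Variable F : fieldType.

Definition ratfun_gcd (r : {fraction {poly F}}) : {poly F} :=
  gcdp (frac (repr r)).1 (frac (repr r)).2.

Definition ratfun_num (r : {fraction {poly F}}) : {poly F} :=
  (frac (repr r)).1 %/ ratfun_gcd r.

Definition ratfun_den (r : {fraction {poly F}}) : {poly F} :=
  (frac (repr r)).2 %/ ratfun_gcd r.

Definition ratfun_degree (r : {fraction {poly F}}) : nat :=
  maxn (size (ratfun_num r)).-1 (size (ratfun_den r)).-1.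

Lemma ratfun_reprE (r : {fraction {poly F}}) :
  r = tofrac (frac (repr r)).1 / tofrac (frac (repr r)).2.
Proof.
have den0 := denom_ratioP (repr r).
apply: (mulIf (x := tofrac (frac (repr r)).2)); first by rewrite tofrac_eq0.
rewrite divfK ?tofrac_eq0 //; move: (reprK r) den0.
move: (repr r) => x <- den0; unlock tofrac; rewrite -[LHS]FracField.pi_mul; apply/eqmodP.
rewrite /= FracField.equivfE /FracField.mulf /= !numden_Ratio;
  by rewrite ?mulr1 ?oner_neq0 // mulrC.
Qed.

Lemma ratfun_degreeE (p q : {poly F}) : q != 0 -> coprimep p q ->
  ratfun_degree (tofrac p / tofrac q) = maxn (size p).-1 (size q).-1.
Proof.
move=> q0 pq; set r := _ / _.
have den0 : (frac (repr r)).2 != 0 := denom_ratioP (repr r).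
have := ratfun_reprE r; rewrite {1}/r => /eqP.
rewrite eqr_div ?tofrac_eq0 // -!tofracM tofrac_eq => /eqP crossE.
have g0 : ratfun_gcd r != 0 by rewrite gcdp_eq0 negb_and den0 orbT.
have nE : (frac (repr r)).1 = ratfun_num r * ratfun_gcd r.
  by rewrite divpK ?dvdp_gcdl.
have dE : (frac (repr r)).2 = ratfun_den r * ratfun_gcd r.
  by rewrite divpK ?dvdp_gcdr.
have nd : coprimep (ratfun_num r) (ratfun_den r).
  by apply: coprimep_div_gcd; rewrite den0 orbT.
move: crossE; rewrite nE dE mulrA (mulrAC _ _ q) => /(mulIf g0) crossE.
have p_n : p %= ratfun_num r.
  rewrite /eqp -(Gauss_dvdpl _ pq) -crossE dvdp_mulr //=.
  by rewrite -(Gauss_dvdpl _ nd) crossE dvdp_mulr.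
have q_d : q %= ratfun_den r.
  rewrite /eqp; rewrite coprimep_sym in pq; rewrite coprimep_sym in nd.
  rewrite -(Gauss_dvdpr _ pq) crossE dvdp_mull //=.
  by rewrite -(Gauss_dvdpr _ nd) -crossE dvdp_mull.
by rewrite /ratfun_degree (eqp_size p_n) (eqp_size q_d).
Qed.

End RationalFunctions.

(* The variable y of the field of complex rational functions. *)
Definition yvar (R : realType) : {fraction {poly R[i]}} := tofrac 'X.

(* [Zn R n] is Z_n as a complex rational function of y. *)
Definition Zn (R : realType) (n : nat) : {fraction {poly R[i]}} :=
  Zpart (gasket n) (yvar R).

(* The defining equation M(y^4) = y^(3^n) Z_n(y) / 2 of the polynomial M_n. *)
Definition is_M (R : realType) (n : nat) (M : {poly int}) : Prop :=
  (map_poly intr M).[yvar R ^+ 4] = yvar R ^+ (3 ^ n) * Zn R n / 2%:R.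

(* Main.v *)
Require Import Defs.
From mathcomp Require Import all_boot all_order all_algebra generic_quotient.
From mathcomp Require Import complex reals ring zify.

Set Implicit Arguments.
Unset Strict Implicit.
Unset Printing Implicit Defensive.

Import Order.TTheory GRing.Theory Num.Theory.
Local Open Scope ring_scope.

(* Let P (resp. Q) be the partition function of the n-th gasket with its three
   corner spins prescribed to be all equal (resp. not all equal): by symmetry
   only these two cases occur, so Z = 2 P + 6 Q.  A spin configuration on the
   glued graph is a triple of configurations on the copies agreeing at the
   shared corners, and summing over the three shared spins gives
     P' = P^3 + 3 P Q^2 + 4 Q^3,   Q' = Q (P + Q) (P + 3 Q).
   After multiplication by y^(3^n), P and Q are integer polynomials p, q in
   x = y^4, starting from p = x and q = 1, and M = p + 3 q.  The leading term
   of M comes from p.  For the divisibility at 2 x + 1, the invariant is that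
   2^(3^n) divides both p + q and 2 q, because
     P' + Q' = (P + Q) ((P + Q)^2 - 2 Q (P + Q) + 2 (2 Q)^2),
     2 Q' = 2 Q (P + Q) ((P + Q) + 2 Q).
   Finally M(0) > 0, so 2 M(y^4) / y^(3^n) is in lowest terms. *)

(** * The recursion on the pair (p, q) *)

Section Decimation.
Variable A : comNzRingType.

Definition decimate (pq : A * A) : A * A :=
  let: (p, q) := pq in
  (p ^+ 3 + 3%:R * p * q ^+ 2 + 4%:R * q ^+ 3, q * (p + q) * (p + 3%:R * q)).

Lemma decimate_dvd2 (t : A) n :
  let pq := iter n decimate (2%:R * t + 1, 1) in
  exists u v, pq.1 + pq.2 = 2%:R ^+ (3 ^ n) * u
              /\ 2%:R * pq.2 = 2%:R ^+ (3 ^ n) * v.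
Proof.
elim: n => [|n /= [u [v]]]; first by exists (t + 1), 1; split=> /=; ring.
case: (iter n _ _) => p q /= [pqE qE].
(* These come from substituting p + q = N u and 2 q = N v in the two identities below; each
   right-hand side is then N^3 times its witness. *)
exists (u ^+ 3 - u ^+ 2 * v + 2%:R * u * v ^+ 2), (u * v * (u + v)).
rewrite expnSr exprM; set N := _ ^+ (3 ^ n) in pqE qE *; split.
  transitivity ((p + q) * ((p + q) ^+ 2 - 2%:R * q * (p + q)
                           + 2%:R * (2%:R * q) ^+ 2)); first by ring.
  by rewrite pqE qE; ring.
transitivity (2%:R * q * (p + q) * (p + q + 2%:R * q)); first by ring.
by rewrite pqE qE; ring.
Qed.

End Decimation.

(** [decimate] is given by integer polynomials. This serves both for substituting 2 x + 1 and for
    evaluating at y^4. *)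
Lemma decimate_rmorph (A B : comNzRingType) (f : {rmorphism A -> B}) p q n :
  iter n (@decimate B) (f p, f q) =
  (f (iter n (@decimate A) (p, q)).1, f (iter n (@decimate A) (p, q)).2).
Proof.
elim: n => //= n ->; case: (iter n _ _) => a b /=.
by rewrite !(rmorphD, rmorphM, rmorphXn, rmorph_nat).
Qed.

(** * Degree, leading coefficient, value at 0 and divisibility of M *)

Definition gasket_pq (n : nat) : {poly int} * {poly int} :=
  iter n (@decimate {poly int}) ('X, 1).

Definition gasket_poly (n : nat) : {poly int} :=
  (gasket_pq n).1 + 3%:R * (gasket_pq n).2.

(** With deg p = N and deg q < N, the term p^3 dominates p', since p q^2 and q^3 have degree at most
    3 N - 2, while q' has degree at most 3 N - 1. *)
Lemma decimate_size (A : idomainType) (p q : {poly A}) N :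
  (0 < N)%N -> p \is monic -> size p = N.+1 -> (size q <= N)%N ->
  let: (p', q') := decimate (p, q) in
  [/\ p' \is monic, size p' = (N * 3).+1 & (size q' <= N * 3)%N].
Proof.
move=> N0 p_mon pE qE /=.
have szM (a b : {poly A}) i j :
    (size a <= i.+1 -> size b <= j.+1 -> size (a * b)%R <= (i + j).+1)%N.
  by move=> ai bj; have := size_polyMleq a b; lia.
have sz3 : (size (3%:R : {poly A}) <= 1)%N.
  by rewrite -polyC_natr size_polyC_leq1.
have sz4 : (size (4%:R : {poly A}) <= 1)%N.
  by rewrite -polyC_natr size_polyC_leq1.
have qE' : (size q <= N.-1.+1)%N by rewrite prednK.
have pE' : (size p <= N.+1)%N by rewrite pE.
have p3 : size (p ^+ 3) = (N * 3).+1.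
  have p30 : p ^+ 3 != 0 by apply/monic_neq0/monic_exp.
  by rewrite -(@prednK (size (p ^+ 3))) ?size_poly_gt0 // size_exp pE.
have rest : (size (3%:R * p * q ^+ 2 + 4%:R * q ^+ 3)%R
             < size (p ^+ 3))%N.
  rewrite p3 ltnS (leq_trans (size_polyD _ _)) // geq_max.
  rewrite !exprS expr0 mulr1.
  have e1 := szM _ _ _ _ (szM _ _ _ _ sz3 pE') (szM _ _ _ _ qE' qE').
  have e2 := szM _ _ _ _ sz4 (szM _ _ _ _ qE' (szM _ _ _ _ qE' qE')).
  by apply/andP; split; [apply: leq_trans e1 _|apply: leq_trans e2 _]; lia.
have spq : (size (p + q)%R <= N.+1)%N.
  by rewrite (leq_trans (size_polyD _ _)) // geq_max pE' ltnW.
have spq3 : (size (p + 3%:R * q)%R <= N.+1)%N.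
  rewrite (leq_trans (size_polyD _ _)) // geq_max pE' /=.
  by rewrite (leq_trans (szM _ _ _ _ sz3 qE')) // add0n prednK.
rewrite -addrA; split.
- by rewrite monicE lead_coefDl // -monicE monic_exp.
- by rewrite size_polyDl.
- by apply: leq_trans (szM _ _ _ _ (szM _ _ _ _ qE' spq) spq3) _; lia.
Qed.

Lemma gasket_pq_size n :
  [/\ (gasket_pq n).1 \is monic, size (gasket_pq n).1 = (3 ^ n).+1
    & (size (gasket_pq n).2 <= 3 ^ n)%N].
Proof.
elim: n => [|n]; first by rewrite monicX size_polyX size_poly1.
rewrite /gasket_pq /= expnSr; case: (iter n _ _) => p q [p_mon pE qE].
by apply: decimate_size; rewrite ?expn_gt0.
Qed.

Lemma size_gasket_pq_lt n :
  (size (3%:R * (gasket_pq n).2)%R < size (gasket_pq n).1)%N.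
Proof.
have [_ -> qE] := gasket_pq_size n.
rewrite ltnS -polyC_natr mul_polyC.
exact: leq_trans (size_scale_leq _ _) qE.
Qed.

Lemma gasket_poly_monic n : gasket_poly n \is monic.
Proof.
have [p_mon _ _] := gasket_pq_size n.
by rewrite monicE lead_coefDl ?size_gasket_pq_lt // -monicE.
Qed.

Lemma size_gasket_poly n : size (gasket_poly n) = (3 ^ n).+1.
Proof.
have [_ pE _] := gasket_pq_size n.
by rewrite size_polyDl ?size_gasket_pq_lt.
Qed.

Lemma gasket_poly_at0_gt0 n : 0 < (gasket_poly n).[0].
Proof.
(* The recursion has nonnegative coefficients; the bound on p is only weak because it starts at
   ['X], which vanishes at 0. *)
suff [p0 q0] : 0 <= (gasket_pq n).1.[0] /\ 0 < (gasket_pq n).2.[0].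
  by rewrite hornerD hornerM -polyC_natr hornerC ltr_wpDl ?mulr_gt0.
elim: n => [|n]; first by rewrite /= hornerX hornerC.
rewrite /gasket_pq /=; case: (iter n _ _) => p q /= [p0 q0].
rewrite -!polyC_natr !(hornerD, hornerM, horner_exp, hornerC); split.
  by rewrite !addr_ge0 // ?mulr_ge0 ?exprn_ge0 // ltW.
by rewrite !mulr_gt0 ?ltr_wpDl ?mulr_gt0.
Qed.

Lemma gasket_poly_comp_dvd2 n :
  exists u : {poly int},
    gasket_poly n \Po (2%:R *: 'X + 1) = 2%:R ^+ (3 ^ n) *: u.
Proof.
have [u [v]] := @decimate_dvd2 {poly int} 'X n.
pose f := @comp_poly int (2%:R *: 'X + 1).
have -> : (2%:R * 'X + 1, 1) = (f 'X, f 1) :> {poly int} * {poly int}.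
  by rewrite /f comp_polyX rmorph1 -mul_polyC polyC_natr.
rewrite (decimate_rmorph (f : {rmorphism {poly int} -> {poly int}})) /=.
move=> -[pqE qE].
(* The sum appears because M = (p + q) + 2 q. *)
exists (u + v); rewrite -[RHS]mul_polyC rmorphXn /= polyC_natr mulrDr.
rewrite -pqE -qE /gasket_poly -polyC_natr comp_polyD comp_polyM comp_polyC.
rewrite -/f polyC_natr /gasket_pq; ring.
Qed.

(** * Configurations on a glued graph as triples of configurations *)

Section Gluing.
Variable G : cgraph.

Definition glue_restrict (s : config (glue G)) (i : 'I_3) : config G :=
  [ffun v => s (copy i v)].

Definition compatible (T : {ffun 'I_3 -> config G}) : bool :=
  [forall i, forall j, T i (corner G j) == T j (corner G i)].

(** Defined for every [T] through chosen representatives; independent of that choice when [T] is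
    compatible. *)
Definition glue_config (T : {ffun 'I_3 -> config G}) : config (glue G) :=
  [ffun x : glue_vertex G => T (repr x).1 (repr x).2].

Lemma glue_configE T i v : compatible T -> glue_config T (copy i v) = T i v.
Proof.
move=> /forallP compT; rewrite ffunE.
have : copy (repr (copy i v)).1 (repr (copy i v)).2 == copy i v.
  by rewrite /copy -surjective_pairing reprK.
case: (repr _) => j w /=; rewrite copyE; case/predU1P => [[-> ->]//|/and3P[_]].
by move=> /eqP /= -> /eqP ->; apply/eqP/(forallP (compT j)).
Qed.

Lemma glue_restrictK s :
  glue_config [ffun i => glue_restrict s i] = s.
Proof.
apply/ffunP => x; rewrite !ffunE; congr (s _).
by rewrite /copy -surjective_pairing reprK.
Qed.

Lemma copy_corner i j : copy i (corner G j) = copy j (corner G i).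
Proof.
apply/eqP; rewrite copyE /glue_rel /= !eqxx !andbT.
by case: (eqVneq i j) => [->|_]; rewrite ?eqxx ?orbT.
Qed.

Lemma compatible_restrict s : compatible [ffun i => glue_restrict s i].
Proof.
by apply/forallP => i; apply/forallP => j; rewrite !ffunE copy_corner.
Qed.

(* Copies share at most one vertex, so no edge lies in two of them. *)
Lemma copy_edge_inj i j e d : e \in edges G -> d \in edges G ->
  copy i @: (e : {set vertex G}) = copy j @: (d : {set vertex G}) ->
  (i, e) = (j, d).
Proof.
move=> eG dG ed; case: (eqVneq i j) => [ij|ij].
  by move: ed; rewrite ij => /(imset_inj (@copy_inj G j)) ->.
suff : (#|e| <= 1)%N by rewrite (edges_card eG).
rewrite -(cards1 (corner G j)); apply/subset_leq_card/subsetP => u ue.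
have : copy i u \in copy j @: d by rewrite -ed imset_f.
case/imsetP => w _ /eqP; rewrite copyE; case/predU1P => [[ij']|/and3P[_ /=]].
  by rewrite ij' eqxx in ij.
by rewrite inE.
Qed.

(** By [copy_edge_inj] each glued edge comes from exactly one pair (copy, edge), so the sum can be
    reindexed by these pairs. *)
Lemma interaction_glue s :
  interaction (G := glue G) s = \sum_i interaction (glue_restrict s i).
Proof.
rewrite pair_big_dep /= /interaction /= /glue_edges.
transitivity (\sum_(p | p.2 \in edges G)
   \prod_(v in copy p.1 @: (p.2 : {set vertex G})) spin (G := glue G) s v).
  rewrite (_ : [set _ | _ in _, _ in _] =
    [set copy p.1 @: (p.2 : {set vertex G})
      | p in [set p : 'I_3 * {set vertex G} | p.2 \in edges G]]); last first.
    apply/setP => x; apply/imset2P/imsetP.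
      by case=> i e _ eG ->; exists (i, e); rewrite ?inE.
    by case=> -[i e]; rewrite inE => eG ->; exists i e.
  rewrite big_imset => [|[i e] [j d]]; first by apply: eq_bigl => p; rewrite inE.
  by rewrite !inE; apply: copy_edge_inj.
apply: eq_bigr => -[i e] _ /=.
have copyP : {in e &, injective (copy (G := G) i)}.
  by move=> u v _ _; exact: copy_inj.
rewrite (big_imset (spin (G := glue G) s) copyP).
by apply: eq_bigr => v _; rewrite /spin ffunE.
Qed.

End Gluing.

Lemma forall_ord3 (P : pred 'I_3) :
  [forall i, P i] = [&& P 0, P 1 & P 2%:R].
Proof.
apply/forallP/and3P => [H|[H0 H1 H2] i]; first by split.
case: i => -[|[|[|//]]] lt_i3.
- by rewrite (_ : Ordinal _ = 0) //; apply: val_inj.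
- by rewrite (_ : Ordinal _ = 1) //; apply: val_inj.
- by rewrite (_ : Ordinal _ = 2%:R) //; apply: val_inj.
Qed.

Lemma prod_ord3 (A : comNzRingType) (F : 'I_3 -> A) :
  \prod_i F i = F 0 * F 1 * F 2%:R.
Proof.
rewrite !big_ord_recl big_ord0 mulr1 mulrA.
by congr (F _ * F _ * F _); apply: val_inj.
Qed.

Lemma sum_ord3 (A : comNzRingType) (F : 'I_3 -> A) :
  \sum_i F i = F 0 + F 1 + F 2%:R.
Proof.
rewrite !big_ord_recl big_ord0 addr0 addrA.
by congr (F _ + F _ + F _); apply: val_inj.
Qed.

(** * Partition functions with prescribed corner spins *)

Section Boundary.
Variables (K : fieldType) (y : K).
Hypothesis y0 : y != 0.

Definition Zcorner (G : cgraph) (c : 'I_3 -> bool) : K :=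
  \sum_(s : config G | [forall i, s (corner G i) == c i]) y ^ interaction s.

Definition corners (a b c : bool) (i : 'I_3) : bool :=
  if val i is i'.+1 then if i' is 0%N then b else c else a.

Lemma ZpartE (G : cgraph) :
  Zpart G y = \sum_a \sum_b \sum_c Zcorner G (corners a b c).
Proof.
under [RHS]eq_bigr do rewrite pair_big.
rewrite pair_big /= /Zpart.
rewrite (partition_big (fun s : config G =>
  (s (corner G 0), (s (corner G 1), s (corner G 2%:R)))) predT) //=.
apply: eq_bigr => -[a [b c]] _; apply: eq_bigl => s.
by rewrite forall_ord3 !xpair_eqE.
Qed.

(** Here [t], [u], [v] are the spins at the vertices shared by copies 0 and 1, 0 and 2, 1 and 2. *)
Lemma Zcorner_glue (G : cgraph) a b c :
  Zcorner (glue G) (corners a b c) =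
  \sum_t \sum_u \sum_v Zcorner G (corners a t u) * Zcorner G (corners t b v)
                       * Zcorner G (corners u v c).
Proof.
(* Entry (i, j) of this table is the spin at corner j of copy i. Its symmetry is compatibility; its
   diagonal is [a], [b], [c]. *)
pose B t u v (i : 'I_3) :=
  corners (corners a t u i) (corners t b v i) (corners u v c i).
transitivity (\sum_(T : {ffun 'I_3 -> config G}
    | compatible T && [forall i, T i (corner G i) == corners a b c i])
    \prod_i y ^ interaction (T i)).
  rewrite /Zcorner (reindex_onto (@glue_config G)
      (fun s => [ffun i => glue_restrict s i])) /=; last first.
    by move=> s _; exact: glue_restrictK.
  apply: eq_big => [T|T /andP[_ /eqP TE]].
    apply/andP/andP => [[cE /eqP TE]|[compT cE]].
      have compT : compatible T by rewrite -TE compatible_restrict.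
      split=> //; apply/forallP=> i; rewrite -glue_configE //.
      exact: (forallP cE i).
    split.
      by apply/forallP=> i; rewrite glue_configE //; exact: (forallP cE i).
    apply/eqP/ffunP => i; rewrite ffunE; apply/ffunP => v.
    by rewrite ffunE glue_configE.
  rewrite interaction_glue.
  under [RHS]eq_bigr do rewrite -{1}TE ffunE.
  by elim/big_rec2: _ => [|i x z _ <-]; rewrite ?expr0z // expfzDr.
under [RHS]eq_bigr do rewrite pair_big.
rewrite pair_big /= (partition_big (fun T : {ffun 'I_3 -> config G} =>
  (T 0 (corner G 1), (T 0 (corner G 2%:R), T 1 (corner G 2%:R)))) predT) //=.
apply: eq_bigr => -[t [u v]] _ /=.
rewrite /Zcorner -(prod_ord3 (fun i => \sum_(s : config G
  | [forall j, s (corner G j) == B t u v i j]) y ^ interaction s)).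
(* The product of three sums expands to a sum over triples; only the two index conditions remain to
   be compared. *)
rewrite bigA_distr_big_dep; apply: eq_bigl => T.
transitivity [forall i, forall j, T i (corner G j) == B t u v i j]; last first.
  by apply: eq_forallb => i; rewrite unfold_in.
rewrite /compatible !forall_ord3 !xpair_eqE /B /corners /=.
(* Once the nine corner spins are generalized, only equalities between booleans are left. *)
do 9!move: (T _ _) => ?.
by apply/idP/idP => H; repeat match goal with
| H : is_true (_ && _) |- _ => case/andP: H => ? ?
| H : is_true (_ == _) |- _ => move/eqP: H => ? end; subst; rewrite ?eqxx.
Qed.

(** The corners are all the vertices, so a single configuration contributes; its interaction is 3 if
    the spins agree and -1 otherwise. *)
Lemma Zcorner_triangle a b c :
  y * Zcorner triangle (corners a b c) =
  if (a == b) && (b == c) then y ^+ 4 else 1.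
Proof.
rewrite /Zcorner (big_pred1 [ffun i => corners a b c i]); last first.
  move=> s /=; apply/forallP/eqP => [H|-> i]; last by rewrite ffunE.
  by apply/ffunP => i; rewrite ffunE; apply/eqP/H.
(* Indexing each edge by the opposite vertex makes the interaction an explicit sum of three
   terms. *)
have edgesE : edges triangle = [set [set~ i] | i : 'I_3].
  apply/setP => e; rewrite inE; apply/eqP/imsetP => [e2|[i _ ->]]; last first.
    by rewrite cardsC1 card_ord.
  have /cards1P[i eE] : #|~: e| == 1%N.
    by rewrite -(eqn_add2l #|e|) cardsC e2 card_ord.
  by exists i; rewrite // -eE setCK.
rewrite /interaction edgesE big_imset => [|i j _ _ /setC_inj /set1_inj //].
rewrite /= sum_ord3.
have prodE i (F : 'I_3 -> int) : \prod_(v in [set~ i]) F v =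
    (if 0 == i then 1 else F 0) * (if 1 == i then 1 else F 1) *
    (if 2%:R == i then 1 else F 2%:R).
  by rewrite big_mkcond prod_ord3 !inE !if_neg.
rewrite !prodE /spin !ffunE /corners /=.
by case: a b c => [] [] []; first [exact: mulfV | reflexivity].
Qed.

Lemma Zcorner_gasket n a b c :
  y ^+ (3 ^ n) * Zcorner (gasket n) (corners a b c) =
  let pq := iter n (@decimate K) (y ^+ 4, 1) in
  if (a == b) && (b == c) then pq.1 else pq.2.
Proof.
elim: n a b c => [|n IH] a b c; first exact: Zcorner_triangle.
rewrite [gasket _]/= Zcorner_glue expnSr exprM; set Y := y ^+ (3 ^ n) in IH *.
(* The factor [Y ^+ 3] is shared out, one [Y] per copy, to match the induction hypothesis. *)
transitivity (\sum_t \sum_u \sum_v (Y * Zcorner (gasket n) (corners a t u))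
    * (Y * Zcorner (gasket n) (corners t b v))
    * (Y * Zcorner (gasket n) (corners u v c))).
  rewrite mulr_sumr; apply: eq_bigr => t _.
  rewrite mulr_sumr; apply: eq_bigr => u _.
  by rewrite mulr_sumr; apply: eq_bigr => v _; ring.
under eq_bigr do under eq_bigr do under eq_bigr do rewrite !IH.
rewrite /=; case: (iter n _ _) => p q /=.
by rewrite !big_bool; case: a b c => [] [] [] /=; ring.
Qed.

(** Of the eight corner conditions two are constant, so the total is 2 p + 6 q = 2 (p + 3 q). *)
Lemma Zpart_gasket n :
  y ^+ (3 ^ n) * Zpart (gasket n) y =
  2%:R * (map_poly intr (gasket_poly n)).[y ^+ 4].
Proof.
have evE : iter n (@decimate K) (y ^+ 4, 1) =
    ((map_poly intr (gasket_pq n).1).[y ^+ 4],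
     (map_poly intr (gasket_pq n).2).[y ^+ 4]).
  rewrite -[LHS](_ : iter n (@decimate K)
    (horner_eval (y ^+ 4) (map_poly intr 'X),
     horner_eval (y ^+ 4) (map_poly intr 1)) = _).
    exact: (decimate_rmorph
      (horner_eval (y ^+ 4) \o map_poly intr : {rmorphism {poly int} -> K})).
  by rewrite map_polyX rmorph1 /horner_eval hornerX hornerC.
rewrite ZpartE mulr_sumr; under eq_bigr do rewrite mulr_sumr.
under eq_bigr do under eq_bigr do rewrite mulr_sumr.
under eq_bigr do under eq_bigr do under eq_bigr do rewrite Zcorner_gasket evE.
rewrite !big_bool /= /gasket_poly rmorphD rmorphM rmorph_nat hornerD hornerM.
rewrite -polyC_natr hornerC; ring.
Qed.

End Boundary.

(** * Uniqueness of M and the degree of Z as a rational function *)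

Section RationalFunction.
Variable R : realType.

Lemma yvar_neq0 : yvar R != 0.
Proof. by rewrite tofrac_eq0 polyX_eq0. Qed.

Lemma map_poly_yvarE (M : {poly int}) :
  (map_poly intr M).[yvar R ^+ 4] =
  tofrac (map_poly (intr : int -> R[i]) M \Po 'X^4).
Proof.
rewrite /comp_poly -horner_map -!map_poly_comp rmorphXn.
congr _.[_]; apply: eq_map_poly => z /=.
by rewrite rmorph_int /= rmorph_int.
Qed.

(** Substituting the nonconstant ['X^4], embedding the integers in the complex numbers and passing
    to fractions are all injective. *)
Lemma is_M_inj n M M' : is_M R n M -> is_M R n M' -> M = M'.
Proof.
rewrite /is_M => <- /eqP; rewrite !map_poly_yvarE tofrac_eq => /eqP MM'.
have intr_poly_inj : injective (map_poly (intr : int -> R[i])).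
  by apply: map_inj_poly => //; exact: intr_inj.
apply: intr_poly_inj; apply/eqP; rewrite -subr_eq0.
by rewrite -(@comp_poly_eq0 _ _ 'X^4) ?size_polyXn // comp_polyB MM' subrr.
Qed.

Lemma is_M_gasket_poly n : is_M R n (gasket_poly n).
Proof.
have two0 : (2%:R : {fraction {poly R[i]}}) != 0.
  by rewrite -(rmorph_nat (@tofrac _)) tofrac_eq0 -polyC_natr polyC_eq0 pnatr_eq0.
by rewrite /is_M /Zn (Zpart_gasket yvar_neq0) mulrC mulKf.
Qed.

Lemma ratfun_degree_Zn n : ratfun_degree (Zn R n) = (4 * 3 ^ n)%N.
Proof.
set P := map_poly (intr : int -> R[i]) (gasket_poly n).
have two0 : (2%:R : R[i]) != 0 by rewrite pnatr_eq0.
have Xn_neq0 : ('X^(3 ^ n) : {poly R[i]}) != 0.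
  by apply: monic_neq0; apply: monicXn.
have -> : Zn R n = tofrac (2%:R *: (P \Po 'X^4)) / tofrac 'X^(3 ^ n).
  apply: (canRL (mulfK _)); first by rewrite tofrac_eq0; exact: Xn_neq0.
  rewrite -mul_polyC polyC_natr tofracM tofracXn mulrC.
  rewrite (Zpart_gasket yvar_neq0) map_poly_yvarE.
  by rewrite (rmorph_nat (@tofrac _)).
rewrite ratfun_degreeE.
- rewrite size_scale // size_polyXn size_comp_poly size_polyXn.
  rewrite size_map_inj_poly ?size_gasket_poly //=; last exact: intr_inj.
  lia.
- exact: Xn_neq0.
(* Coprimality with a power of ['X] amounts to a nonzero value at 0, which here is M(0) > 0. *)
- rewrite coprimepZl // coprimep_expr // coprimepX.
  rewrite /root horner_comp hornerXn expr0n /=.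
  have -> : P.[0] = (gasket_poly n).[0]%:~R by rewrite -horner_map rmorph0.
  by rewrite intr_eq0 gt_eqF ?gasket_poly_at0_gt0.
Qed.

End RationalFunction.

Theorem corollary1p3 (R : realType) (n : nat) :
  (exists M : {poly int},
     [/\ unique (is_M R n) M,
         M \is monic,
         size M = (3 ^ n).+1%N &
         (2%:R ^+ (3 ^ n))^-1 *:
           (map_poly (intr : int -> rat) M \Po (2%:R *: 'X + 1))
           \is a polyOver Num.int])
  /\ ratfun_degree (Zn R n) = (4 * 3 ^ n)%N.
Proof.
split; last exact: ratfun_degree_Zn.
exists (gasket_poly n); split.
- by split=> [|M' /(is_M_inj (is_M_gasket_poly R n))]; first exact: is_M_gasket_poly.
- exact: gasket_poly_monic.
- exact: size_gasket_poly.
have [u uE] := gasket_poly_comp_dvd2 n.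
(* The substitution is itself integral, so the division can be carried out over the integers
   first. *)
have -> : (2%:R *: 'X + 1 : {poly rat}) = map_poly intr (2%:R *: 'X + 1).
  by rewrite rmorphD /= map_polyZ map_polyX rmorph1 rmorph_nat.
rewrite -map_comp_poly uE map_polyZ rmorphXn rmorph_nat scalerK; last first.
  by rewrite expf_neq0 ?pnatr_eq0.
by apply/polyOverP => i; rewrite coef_map intr_int.
Qed.
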